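(* Let $\boldsymbol f,\boldsymbol{\mathcal C},\boldsymbol{\mathcal C}(\cdot),\Pi_\perp,\mathcal Y^\star$ be as defined in the context, and assume that for each $i\in\mathcal I$ the function $f_i:\mathbb R^{n_y}\to\mathbb R$ is convex and $L$-smooth (differentiable with $L$-Lipschitz gradient), with $L>0$. For every $p\in\mathcal P$ let $A_p,B_p,C_p,D_p\in\mathbb R^{N_p\times N_p}$, and set $A=\operatorname{diag}((A_p\otimes I_{n_{y_p}})_{p\in\mathcal P})$, $B=\operatorname{diag}((B_p\otimes I_{n_{y_p}})_{p\in\mathcal P})$, $C=\operatorname{diag}((C_p\otimes I_{n_{y_p}})_{p\in\mathcal P})$, $D=\operatorname{diag}((D_p\otimes I_{n_{y_p}})_{p\in\mathcal P})$. Assume that: (a) $A=BD$, $B\succcurlyeq 0$ and $D\succ 0$; (b) for all $\boldsymbol y\in\boldsymbol{\mathcal C}$, $D\boldsymbol y=\boldsymbol y$ and $B\boldsymbol y=\boldsymbol y$; (c) $C\succcurlyeq 0$ and $\operatorname{null}(C)=\boldsymbol{\mathcal C}$; (d) $BC=CB$; (e) $I-\tfrac12 C-\sqrt B\,D\,\sqrt B\succcurlyeq 0$. Let $y^\star\in\mathcal Y^\star$, $\boldsymbol y^\star:=\boldsymbol{\mathcal C}(y^\star)$, and consider the merit function $$\mathfrak M(\boldsymbol y):=\max\bigl\{\|\Pi_\perp\boldsymbol y\|\,\|\nabla\boldsymbol f(\boldsymbol y^\star)\|,\ |\boldsymbol f(\boldsymbol y)-\boldsymbol f(\boldsymbol y^\star)|\bigr\}.$$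 Then, for any $\boldsymbol y^0\in\mathbb R^{n_{\boldsymbol y}}$, $\boldsymbol z^0=\boldsymbol 0$, and $\gamma\in\bigl(0,\tfrac{\lambda_{\min}(D)}{L}\bigr)$, the sequence $(\boldsymbol y^k)_{k\in\mathbb N}$ generated by $$\boldsymbol y^{k+1}=A\boldsymbol y^k-\gamma B\nabla\boldsymbol f(\boldsymbol y^k)-\boldsymbol z^k,\qquad \boldsymbol z^{k+1}=\boldsymbol z^k+C\boldsymbol y^{k+1}$$ satisfies $\mathfrak M(\boldsymbol y_{\rm avg}^k)\le\mathcal O(1/k)$, where $\boldsymbol y_{\rm avg}^k:=\frac1k\sum_{t=1}^k\boldsymbol y^t$; that is, there is a constant $c\ge 0$ independent of $k$ such that $\mathfrak M(\boldsymbol y^k_{\rm avg})\le c/k$ for all integers $k\ge1$.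
   Context: Agents are $\mathcal I=\{1,\dots,N\}$. The optimization variable $y\in\mathbb R^{n_y}$ is partitioned as $y=\operatorname{col}((y_p)_{p\in\mathcal P})$, $\mathcal P=\{1,\dots,P\}$, $y_p\in\mathbb R^{n_{y_p}}$ ($\operatorname{col}$ denotes vertical stacking, $\operatorname{diag}$ of matrices the block-diagonal matrix). Interference graph: a bipartite graph with edge set $\mathcal E^I\subseteq\mathcal P\times\mathcal I$ specifying that $f_i(y)$ depends only on the components $y_p$ with $(p,i)\in\mathcal E^I$; every $p$ has at least one $i$ with $(p,i)\in\mathcal E^I$. Estimate graph: a bipartite graph with edge set $\mathcal E^E\subseteq\mathcal P\times\mathcal I$ with $\mathcal E^I\subseteq\mathcal E^E$. Agent $i$ keeps an estimate $\boldsymbol y_{i,p}\in\mathbb R^{n_{y_p}}$ of $y_p$ iff $(p,i)\in\mathcal E^E$. Write $\mathcal N^E(i)=\{p:(p,i)\in\mathcal E^E\}$, $\overline{\mathcal N}^E(p)=\{i:(p,i)\in\mathcal E^E\}$, $N_p=|\overline{\mathcal N}^E(p)|$. The problem is $\min_{y\in\mathbb R^{n_y}} f(y):=\sum_{i\in\mathcal I}f_i(y)$, with solution set $\mathcal Y^\star$, assumed nonempty. Since $f_i$ depends only on $(y_p)_{(p,i)\in\mathcal E^I}$, it can also be evaluated at $\tilde{\boldsymbol y}_i:=\operatorname{col}((\boldsymbol y_{i,p})_{p\in\mathcal N^E(i)})$, written $f_i(\tilde{\boldsymbol y}_i)$. Stacked notation: $\boldsymbol y_p:=\operatorname{col}((\boldsymbol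 y_{i,p})_{i\in\overline{\mathcal N}^E(p)})\in\mathbb R^{N_pn_{y_p}}$ (agents in increasing order), $\boldsymbol y:=\operatorname{col}((\boldsymbol y_p)_{p\in\mathcal P})\in\mathbb R^{n_{\boldsymbol y}}$, $n_{\boldsymbol y}=\sum_pN_pn_{y_p}$; the vector $\boldsymbol z\in\mathbb R^{n_{\boldsymbol y}}$ is partitioned in the same way. $\boldsymbol f(\boldsymbol y):=\sum_{i\in\mathcal I}f_i(\tilde{\boldsymbol y}_i)$, and $\nabla\boldsymbol f$ is its gradient with respect to $\boldsymbol y$. Consensus space: $\boldsymbol{\mathcal C}:=\prod_{p\in\mathcal P}\{\mathbf 1_{N_p}\otimes v: v\in\mathbb R^{n_{y_p}}\}\subseteq\mathbb R^{n_{\boldsymbol y}}$, and for $y\in\mathbb R^{n_y}$, $\boldsymbol{\mathcal C}(y):=\operatorname{col}((\mathbf 1_{N_p}\otimes y_p)_{p\in\mathcal P})$. $\Pi_\perp$ is the orthogonal projection of $\mathbb R^{n_{\boldsymbol y}}$ onto the orthogonal complement of $\boldsymbol{\mathcal C}$. $M\succcurlyeq0$ (resp. $M\succ0$) means $M$ is symmetric positive semidefinite (resp. definite), $\sqrt B$ is the positive semidefinite square root, and $\lambda_{\min}$ is the smallest eigenvalue. *)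

(* Defs.v *)
From mathcomp Require Export all_boot all_order all_algebra.
From mathcomp Require Export all_classical all_reals all_analysis.
From mathcomp.real_closed Require Export mxtens.

Set Implicit Arguments.
Unset Strict Implicit.
Unset Printing Implicit Defensive.

Export Order.TTheory GRing.Theory Num.Theory.
Export numFieldNormedType.Exports.

Local Open Scope classical_set_scope.
Local Open Scope ring_scope.

Section Euclidean.
Context {R : realType} {n : nat}.
Implicit Types (x y : 'cV[R]_n) (M : 'M[R]_n) (V : set 'cV[R]_n).

Definition dot x y : R := \sum_i x i 0 * y i 0.

(* The library norm [`|x|] of a matrix is the maximum norm. *)
Definition enorm x : R := Num.sqrt (dot x x).

Definition orthc V : set 'cV[R]_n := [set x | forall y, V y -> dot x y = 0].

(* The orthogonal projection of x onto the subspace V: the unique w in V with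
   x - w orthogonal to V. *)
Definition oproj V x : 'cV[R]_n := xget 0 [set w | V w /\ orthc V (x - w)].

Definition mxnull M : set 'cV[R]_n := [set x | M *m x = 0].

Definition psd M : Prop := M^T = M /\ forall x, 0 <= dot x (M *m x).

Definition posdef M : Prop :=
  M^T = M /\ forall x, x != 0 -> 0 < dot x (M *m x).

(* For M positive semidefinite there is exactly one such S. *)
Definition sqrtmx M : 'M[R]_n := xget 0 [set S | psd S /\ S *m S = M].

(* For symmetric M and n > 0 the set of (real) eigenvalues is finite and
   nonempty, so that the infimum is a minimum. *)
Definition lambda_min M : R := inf [set l | eigenvalue M l].

Definition grad (f : 'cV[R]_n -> R) x : 'cV[R]_n :=
  \col_i 'D_(delta_mx i 0) f x.

Definition L_smooth (L : R) (f : 'cV[R]_n -> R) : Prop :=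
  (forall x, differentiable f x) /\
  (forall x y, enorm (grad f x - grad f y) <= L * enorm (x - y)).

Definition minimizers (f : 'cV[R]_n -> R) : set 'cV[R]_n :=
  [set x | forall y, f x <= f y].

End Euclidean.

(* P variable blocks, block p of dimension [n p], and N agents. A bipartite
   graph between blocks and agents is given by its set of edges. *)
Section Network.
Context {R : realType} {P N : nat}.
Variables (EE : {set 'I_P * 'I_N}) (n : 'I_P -> nat).

Definition nbrs (p : 'I_P) : {set 'I_N} := [set i | (p, i) \in EE].

Definition deg (p : 'I_P) : nat := #|nbrs p|.

Definition depends_only_on (E : {set 'I_P * 'I_N}) (i : 'I_N)
    (f : 'cV[R]_(\sum_p n p) -> R) : Prop :=
  forall x y : 'cV[R]_(\sum_p n p),
    (forall p, (p, i) \in E -> submxcol x p = submxcol y p) -> f x = f y.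

(* The a-th estimate of block p in the stacked vector Y; it is held by the a-th
   agent [enum_val a] of [nbrs p], in increasing order. *)
Definition estimate (Y : 'cV[R]_(\sum_p deg p * n p)) (p : 'I_P)
    (a : 'I_(deg p)) : 'cV[R]_(n p) :=
  \col_j submxcol Y p (mxtens_index (a, j)) 0.

(* The estimates held by agent i, completed by zero in the blocks that agent i
   does not estimate; a function that depends only on the blocks estimated by
   agent i is not affected by the completion. *)
Definition local_estimates (Y : 'cV[R]_(\sum_p deg p * n p)) (i : 'I_N) :
    'cV[R]_(\sum_p n p) :=
  \mxcol_p (if [pick a : 'I_(deg p) | enum_val a == i] is Some a
            then estimate Y a else 0).

Definition stacked_cost (f : 'I_N -> 'cV[R]_(\sum_p n p) -> R)
    (Y : 'cV[R]_(\sum_p deg p * n p)) : R :=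
  \sum_i f i (local_estimates Y i).

Definition consensus : set 'cV[R]_(\sum_p deg p * n p) :=
  [set Y | exists v : forall p, 'cV[R]_(n p),
      Y = \mxcol_p ((const_mx 1 : 'cV[R]_(deg p)) *t v p)].

Definition consensus_at (y : 'cV[R]_(\sum_p n p)) :
    'cV[R]_(\sum_p deg p * n p) :=
  \mxcol_p ((const_mx 1 : 'cV[R]_(deg p)) *t submxcol y p).

Definition diag_kron (M : forall p, 'M[R]_(deg p)) :
    'M[R]_(\sum_p deg p * n p) :=
  \mxdiag_p (M p *t (1%:M : 'M[R]_(n p))).

Definition merit (f : 'I_N -> 'cV[R]_(\sum_p n p) -> R)
    (Ystar Y : 'cV[R]_(\sum_p deg p * n p)) : R :=
  Num.max
    (enorm (oproj (orthc consensus) Y) * enorm (grad (stacked_cost f) Ystar))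
    `|stacked_cost f Y - stacked_cost f Ystar|.

End Network.

Arguments consensus {R P N} EE n.

Definition avg {R : realType} {n : nat} (y : nat -> 'cV[R]_n) (k : nat) :
    'cV[R]_n :=
  k%:R^-1 *: \sum_(1 <= t < k.+1) y t.

(* Main.v *)
From HB Require Import structures.
Require Import Defs.
From mathcomp Require Import ring lra spectral.
From mathcomp.real_closed Require Import complex.

(* With w^0 = 0, z^k = BC w^k, y^{k+1} = B x^{k+1} and w^{k+1} = w^k + x^{k+1},
   the iteration becomes x^{k+1} = D y^k - gamma grad f(y^k) - C w^k, so that no
   inverse of B or C is needed. For every q, hypothesis (e) tested at
   sqrt(B) x^{k+1}, together with convexity and L-smoothness, shows that
   gamma (f(y^{k+1}) - f(y_star)) + <Cq, y^{k+1}> is at most the decrease of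
     (|y - y_star|_D^2 + |w - q|_{BC}^2) / 2.
   Summing bounds the gap of the averaged iterate by O(1/k), and q is chosen so
   that Cq is 2 gamma |grad f(y_star)| times the unit vector along the
   projection of the average onto the orthogonal complement of the consensus
   space, while f(avg) - f(y_star) >= - |grad f(y_star)| |projection|.
   Square roots and the smallest eigenvalue are handled by polynomials in a
   symmetric matrix, which is annihilated by a product of distinct real linear
   factors. *)

Set Implicit Arguments.
Unset Strict Implicit.
Unset Printing Implicit Defensive.

Local Open Scope classical_set_scope.
Local Open Scope ring_scope.

(** The choice [t = - a / (b + 1)] turns the quadratic into [- (a / (b + 1)) ^+ 2]; the shift by 1
    covers [b = 0]. *)
Lemma linear_coef_eq0 {R : realFieldType} (a b : R) :
  0 <= b -> (forall t, 0 <= t ^+ 2 * b + t * a) -> a = 0.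
Proof.
move=> b_ge0 /(_ (- a / (b + 1))).
have -> : (- a / (b + 1)) ^+ 2 * b + - a / (b + 1) * a = - (a / (b + 1)) ^+ 2.
  by field; rewrite gt_eqF//; lra.
rewrite oppr_ge0 => a_le0; have /eqP : (a / (b + 1)) ^+ 2 = 0.
  by apply/eqP; rewrite eq_le a_le0 sqr_ge0.
rewrite sqrf_eq0 mulf_eq0 invr_eq0 => /orP[/eqP//|/eqP b0]; lra.
Qed.

(** * Inner product and positive semidefinite matrices *)

Section Dot.
Context {R : realType} {n : nat}.
Implicit Types (x y : 'cV[R]_n) (M S : 'M[R]_n).

Lemma dotC x y : dot x y = dot y x.
Proof. by apply: eq_bigr => i _; rewrite mulrC. Qed.

Lemma dotDl x x' y : dot (x + x') y = dot x y + dot x' y.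
Proof. by rewrite -big_split; apply: eq_bigr => i _; rewrite mxE mulrDl. Qed.

Lemma dotZl a x y : dot (a *: x) y = a * dot x y.
Proof. by rewrite mulr_sumr; apply: eq_bigr => i _; rewrite mxE mulrA. Qed.

Lemma dotDr x y y' : dot x (y + y') = dot x y + dot x y'.
Proof. by rewrite !(dotC x) dotDl. Qed.

Lemma dotZr a x y : dot x (a *: y) = a * dot x y.
Proof. by rewrite !(dotC x) dotZl. Qed.

Lemma dotNl x y : dot (- x) y = - dot x y.
Proof. by rewrite -scaleN1r dotZl mulN1r. Qed.

Lemma dotNr x y : dot x (- y) = - dot x y.
Proof. by rewrite !(dotC x) dotNl. Qed.

Definition dotE := (dotDl, dotDr, dotNl, dotNr, dotZl, dotZr).

Lemma dot0l y : dot 0 y = 0.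
Proof. by rewrite -(scale0r 0) dotZl mul0r. Qed.

Lemma dot0r x : dot x 0 = 0.
Proof. by rewrite dotC dot0l. Qed.

Lemma dot_suml I (r : seq I) (P : pred I) (F : I -> 'cV[R]_n) y :
  dot (\sum_(i <- r | P i) F i) y = \sum_(i <- r | P i) dot (F i) y.
Proof. by elim/big_ind2: _ => [|u a v b <- <-|//]; rewrite ?dot0l ?dotDl. Qed.

Lemma dot_sumr I (r : seq I) (P : pred I) (F : I -> 'cV[R]_n) y :
  dot y (\sum_(i <- r | P i) F i) = \sum_(i <- r | P i) dot y (F i).
Proof. by rewrite dotC dot_suml; apply: eq_bigr => i _; rewrite dotC. Qed.

Lemma dot_trmx x y : dot x y = (x^T *m y) 0 0.
Proof. by rewrite mxE; apply: eq_bigr => i _; rewrite mxE. Qed.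

Lemma dot_mulmx M x y : dot x (M *m y) = dot (M^T *m x) y.
Proof. by rewrite !dot_trmx trmx_mul trmxK mulmxA. Qed.

Lemma dot_ge0 x : 0 <= dot x x.
Proof. by apply: sumr_ge0 => i _; rewrite -expr2 sqr_ge0. Qed.

Lemma dot_eq0 x : dot x x = 0 -> x = 0.
Proof.
move=> /eqP; rewrite psumr_eq0 => [/allP x0|i _]; last by rewrite -expr2 sqr_ge0.
apply/colP => i; have := x0 i (mem_index_enum i).
by rewrite -expr2 sqrf_eq0 mxE => /eqP.
Qed.

Lemma enorm_ge0 x : 0 <= enorm x.
Proof. exact: sqrtr_ge0. Qed.

Lemma enorm_sqr x : enorm x ^+ 2 = dot x x.
Proof. by rewrite sqr_sqrtr ?dot_ge0. Qed.

Lemma enormZ a x : enorm (a *: x) = `|a| * enorm x.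
Proof. by rewrite /enorm !dotE mulrA -expr2 sqrtrM ?sqr_ge0// sqrtr_sqr. Qed.

Lemma cauchy_schwarz x y : `|dot x y| <= enorm x * enorm y.
Proof.
rewrite -sqrtrM ?dot_ge0// -sqrtr_sqr ler_sqrt ?mulr_ge0 ?dot_ge0//.
have := dot_ge0 x; rewrite le_eqVlt => /orP[/eqP x0|x_gt0].
  by rewrite -x0 (dot_eq0 (esym x0)) dot0l expr0n mul0r.
rewrite -(ler_pM2l x_gt0) -subr_ge0.
(* This squared norm is [dot x x] times the Cauchy-Schwarz deficit. *)
have := dot_ge0 (dot x x *: y - dot x y *: x).
rewrite !dotE (dotC y x); congr (_ <= _); ring.
Qed.

Lemma psd_sqr S : S^T = S -> psd (S *m S).
Proof.
move=> S_sym; split=> [|x]; first by rewrite trmx_mul S_sym.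
by rewrite -mulmxA dot_mulmx S_sym dot_ge0.
Qed.

(** The form at [t *: (M *m x) - x] is a nonnegative quadratic in t without constant term, so its
    linear coefficient -2 |Mx|^2 vanishes. *)
Lemma psd_kernel M x : psd M -> dot x (M *m x) = 0 -> M *m x = 0.
Proof.
move=> [Msym Mge0] x0; apply: dot_eq0; set y := M *m x.
suff: - 2 * dot y y = 0 by lra.
apply: (linear_coef_eq0 (Mge0 y)) => t; have := Mge0 (t *: y - x).
rewrite mulmxBr -scalemxAr !dotE x0 [dot x (M *m y)]dot_mulmx Msym.
rewrite [dot (M *m x) y]dotC; congr (_ <= _); rewrite -/y; ring.
Qed.

(** For w = (S - S') x, commutation gives (S + S') w = 0, so both forms vanish at w; hence S w = S'
    w = 0 and |w|^2 = <x, (S - S') w> = 0. *)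
Lemma psd_sqrt_unique S S' :
  psd S -> psd S' -> S *m S' = S' *m S -> S *m S = S' *m S' -> S = S'.
Proof.
move=> Spsd S'psd SS' SSe.
have kill (x : 'cV[R]_n) : (S - S') *m x = 0.
  pose w := (S - S') *m x.
  have ww : dot w (S *m w) + dot w (S' *m w) = 0.
    rewrite -dotDr -mulmxDl [X in dot w X](_ : _ = 0) ?dot0r// mulmxA.
    by rewrite mulmxDl !mulmxBr SS' SSe addrA subrK subrr mul0mx.
  have Sw : S *m w = 0.
    apply: psd_kernel => //; have := Spsd.2 w; have := S'psd.2 w; lra.
  have S'w : S' *m w = 0.
    apply: psd_kernel => //; have := Spsd.2 w; have := S'psd.2 w; lra.
  apply: dot_eq0; rewrite dot_mulmx linearB /= Spsd.1 S'psd.1.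
  by rewrite mulmxBl Sw S'w subrr dot0l.
apply/subr0_eq/matrixP => i j; rewrite [RHS]mxE.
have /matrixP/(_ i 0) := kill (delta_mx j 0).
by rewrite -colE mxE => ->; rewrite mxE.
Qed.

End Dot.

(** * Polynomials in a symmetric matrix: square roots and the smallest eigenvalue *)

Lemma sym_mxminpoly {R : realType} {n} (M : 'M[R]_n.+1) : M^T = M ->
  exists2 rs : seq R, uniq rs & mxminpoly M = \prod_(r <- rs) ('X - r%:P).
Proof.
(* The complexified matrix is Hermitian, hence diagonalizable with real eigenvalues, and the minimal
   polynomial of a diagonal matrix has its distinct entries as simple roots. The factorization
   descends along [iota]. *)
move=> M_sym; pose iota := real_complex R; pose Mc := map_mx iota M.
have Mc_herm : Mc \is hermsymmx.
  apply: realsym_hermsym.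
    by apply/is_hermitianmxP; rewrite expr0 scale1r map_mx_id// map_trmx M_sym.
  by apply/mxOverP => i j; rewrite mxE complex_real.
have /orthomx_spectralP Mc_eq := hermitian_normalmx Mc_herm.
have Mc_diag : Mc = conjmx (invmx (spectralmx Mc)) (diag_mx (spectral_diag Mc)).
  by rewrite conjVmx ?spectral_unit.
have Mc_min : mxminpoly Mc =
    \prod_(r <- undup [seq spectral_diag Mc 0 i | i <- enum 'I_n.+1]) ('X - r%:P).
  by rewrite {1}Mc_diag mxminpoly_uconj ?unitmx_inv ?spectral_unit// mxminpoly_diag.
set rs := undup _ in Mc_min.
have rs_real r : r \in rs -> r = iota (complex.Re r).
  rewrite mem_undup => /mapP[i _ ->].
  have /mxOverP/(_ 0 i) := hermitian_spectral_diag_real Mc_herm.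
  by case/complex_realP => k ->.
exists (map (@complex.Re _) rs).
  rewrite map_inj_in_uniq ?undup_uniq// => r s /rs_real -> /rs_real ->.
  by move=> /= ->.
apply: (@map_poly_inj _ _ iota); rewrite -mxminpoly_map -/Mc Mc_min big_map.
rewrite rmorph_prod /= !big_seq; apply: eq_bigr => r /rs_real {1}->.
by rewrite rmorphB /= map_polyX map_polyC.
Qed.

Lemma interpolation {F : fieldType} (rs : seq F) (v : F -> F) : uniq rs ->
  exists p : {poly F}, {in rs, forall r, p.[r] = v r}.
Proof.
elim: rs => [|a rs IH] /=; first by exists 0.
case/andP => a_rs /IH[p pv].
pose q := \prod_(r <- rs) ('X - r%:P).
have qa : q.[a] != 0 by rewrite -/(root q a) root_prod_XsubC.
(* The correction vanishes at the earlier nodes and repairs the value at a. *)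
exists (p + ((v a - p.[a]) / q.[a]) *: q) => r; rewrite inE !hornerE.
case/orP => [/eqP ->|r_rs]; first by rewrite divfK// addrC subrK.
have /eqP -> : root q r by rewrite root_prod_XsubC.
by rewrite mulr0 addr0 pv.
Qed.

Lemma horner_mx_sym {R : realType} {n} (M : 'M[R]_n.+1) p :
  M^T = M -> (horner_mx M p)^T = horner_mx M p.
Proof.
move=> M_sym; elim/poly_ind: p => [|p c IH]; first by rewrite rmorph0 trmx0.
rewrite rmorphD rmorphM /= horner_mx_X horner_mx_C linearD /= tr_scalar_mx.
rewrite trmx_mul M_sym IH; congr (_ + _); exact: comm_mx_horner.
Qed.

(* q interpolates the square root of p at the eigenvalues of M. *)
Lemma horner_mx_sqrt {R : realType} {n} (M : 'M[R]_n.+1) (p : {poly R}) :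
  M^T = M -> (forall r, eigenvalue M r -> 0 <= p.[r]) ->
  exists q : {poly R}, horner_mx M q *m horner_mx M q = horner_mx M p /\
    (forall r, eigenvalue M r -> 0 <= q.[r]).
Proof.
move=> M_sym p_ge0; have [rs rs_uniq M_min] := sym_mxminpoly M_sym.
have eig r : eigenvalue M r = (r \in rs).
  by rewrite eigenvalue_root_min M_min root_prod_XsubC.
have [q qE] := interpolation (fun r => Num.sqrt p.[r]) rs_uniq.
exists q; split=> [|r]; last by rewrite eig => /qE ->; rewrite sqrtr_ge0.
apply/subr0_eq; rewrite -[_ *m _]rmorphM -rmorphB /=.
apply/mxminpoly_minP; rewrite M_min.
apply: uniq_roots_dvdp; last by rewrite uniq_rootsE.
apply/allP => r r_rs; rewrite rootE !hornerE qE//.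
by rewrite -expr2 sqr_sqrtr ?subrr// p_ge0// eig.
Qed.

Lemma eigenvalueP_col {R : realType} {n} (M : 'M[R]_n) r :
  M^T = M -> eigenvalue M r -> exists2 x : 'cV[R]_n, x != 0 & M *m x = r *: x.
Proof.
move=> M_sym /eigenvalueP[v vM v0]; exists v^T.
  by rewrite -(inj_eq (@trmx_inj _ _ _)) trmxK trmx0.
by rewrite -{1}M_sym -trmx_mul vM linearZ.
Qed.

Lemma psd_eigenvalue_ge0 {R : realType} {n} (M : 'M[R]_n) r :
  psd M -> eigenvalue M r -> 0 <= r.
Proof.
move=> [M_sym M_ge0] /(eigenvalueP_col M_sym)[x x0 Mx].
have xx : 0 < dot x x.
  by rewrite lt_neqAle dot_ge0 andbT eq_sym; apply: contra x0 => /eqP/dot_eq0 ->.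
by have := M_ge0 x; rewrite Mx dotZr pmulr_lge0.
Qed.

Lemma posdef_psd {R : realType} {n} (M : 'M[R]_n) : posdef M -> psd M.
Proof.
move=> [M_sym M_gt0]; split=> // x; have [->|/M_gt0/ltW//] := eqVneq x 0.
by rewrite dot0l.
Qed.

(** The matrix [M - lambda_min M] is a polynomial in M that is nonnegative on the spectrum, hence
    the square of a symmetric matrix. *)
Lemma lambda_min_le {R : realType} {n} (M : 'M[R]_n) x :
  psd M -> lambda_min M * dot x x <= dot x (M *m x).
Proof.
case: n M x => [M x M_psd|n M x M_psd].
  by rewrite /dot !big_ord0 mulr0.
pose p : {poly R} := 'X - (lambda_min M)%:P.
have [|q [qE _]] := @horner_mx_sqrt _ _ M p M_psd.1.
  move=> r er; rewrite !hornerE subr_ge0 /lambda_min; apply: ge_inf => //.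
  by exists 0 => s /= /(psd_eigenvalue_ge0 M_psd).
have := (psd_sqr (horner_mx_sym q M_psd.1)).2 x.
rewrite qE rmorphB /= horner_mx_X horner_mx_C mulmxBl mul_scalar_mx.
by rewrite !dotE subr_ge0.
Qed.

(** By uniqueness the chosen root is a polynomial in M, which gives the commutation property. *)
Lemma sqrtmx_psd {R : realType} {n} (M : 'M[R]_n) : psd M ->
  [/\ psd (sqrtmx M), sqrtmx M *m sqrtmx M = M &
      forall X, M *m X = X *m M -> sqrtmx M *m X = X *m sqrtmx M].
Proof.
case: n M => [M _|n M M_psd].
  split=> [||X _]; rewrite ?[_ *m _]flatmx0 ?[RHS]flatmx0//.
  by split=> [|x]; [rewrite [LHS]flatmx0 [RHS]flatmx0 | rewrite /dot big_ord0].
have [|q [qE q_ge0]] := @horner_mx_sqrt _ _ M 'X M_psd.1.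
  by move=> r er; rewrite hornerX (psd_eigenvalue_ge0 M_psd er).
(* A fourth root of M: it exhibits the candidate root as a square, hence as positive
   semidefinite. *)
have [q4 [q4E _]] := horner_mx_sqrt M_psd.1 q_ge0.
have S_psd : psd (horner_mx M q).
  by rewrite -q4E; apply: psd_sqr; exact: horner_mx_sym M_psd.1.
rewrite horner_mx_X in qE.
have -> : sqrtmx M = horner_mx M q.
  have [S'_psd S'E] : psd (sqrtmx M) /\ sqrtmx M *m sqrtmx M = M.
    by apply: (@xgetPex _ 0 [set S | psd S /\ S *m S = M]); exists (horner_mx M q).
  apply: psd_sqrt_unique => //; last by rewrite S'E qE.
  (* [sqrtmx M] commutes with its square M, hence with every polynomial in M. *)
  by apply: comm_mx_horner; rewrite /comm_mx -[X in _ *m X = _]S'E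
    -[X in _ = X *m _]S'E mulmxA.
by split=> // X MX; exact: comm_horner_mx.
Qed.

Lemma quad_form_le {R : realType} {n} (M : 'M[R]_n) :
  exists2 c : R, 0 <= c & forall x, dot x (M *m x) <= c * dot x x.
Proof.
exists (\sum_i \sum_j `|M i j|) => [|x]; first by do 2!apply: sumr_ge0 => ? _.
rewrite mulr_suml ler_sum// => i _; rewrite mxE mulr_sumr mulr_suml.
rewrite ler_sum// => j _.
have le_dot k : x k 0 ^+ 2 <= dot x x.
  rewrite [dot x x](bigD1 k)//= -expr2 lerDl.
  by apply: sumr_ge0 => l _; rewrite -expr2 sqr_ge0.
rewrite mulrCA; apply: (le_trans (ler_norm _)).
rewrite normrM ler_wpM2l// ler_norml.
have := le_dot i; have := le_dot j.
have := sqr_ge0 (x i 0 + x j 0); have := sqr_ge0 (x i 0 - x j 0); nra.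
Qed.

(** * Projection onto the orthogonal complement of a kernel *)

Section Kernel.
Context {R : realType} {n : nat} (C : 'M[R]_n).
Hypothesis C_sym : C^T = C.

(* [C *m C] and C have the same kernel, hence the same rank. *)
Lemma sym_factor : exists K : 'M[R]_n, C *m C *m K = C.
Proof.
have ker_le : (kermx (C *m C) <= kermx C)%MS.
  apply/sub_kermxP/row_matrixP => i; rewrite row0 row_mul.
  set v := row i _; have vCC : v *m (C *m C) = 0.
    by rewrite /v -row_mul mulmx_ker row0.
  apply: trmx_inj; rewrite trmx0; apply: dot_eq0.
  by rewrite dot_trmx trmxK trmx_mul C_sym !mulmxA -(mulmxA v) vCC mul0mx mxE.
have: (C <= C *m C)%MS.
  have := mxrank_leqif_sup (submxMl C C); case=> _ <-.
  rewrite eqn_leq mxrankM_maxl /=.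
  by have := mxrankS ker_le; rewrite !mxrank_ker leq_sub2lE// rank_leq_row.
case/submxP => K CE; exists K^T.
by apply: trmx_inj; rewrite !trmx_mul trmxK C_sym -CE.
Qed.

(** The difference d = x - CKx is killed by C, so it is orthogonal both to x and to the range of
    C. *)
Lemma orthc_null_range K x :
  C *m C *m K = C -> orthc (mxnull C) x -> C *m (K *m x) = x.
Proof.
move=> CCK x_orth; apply/esym/subr0_eq; set d := x - _.
have Cd : C *m d = 0 by rewrite mulmxBr !mulmxA CCK subrr.
apply: dot_eq0; rewrite {1}dotDl dotNl x_orth// dotC dot_mulmx C_sym Cd dot0l.
by rewrite subr0.
Qed.

(** Existence of the projection is witnessed by CKx. The second conclusion lets the average be
    replaced by its projection inside inner products. *)
Lemma oproj_orthc_null x (w := oproj (orthc (mxnull C)) x) :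
  orthc (mxnull C) w /\
  (forall g, orthc (mxnull C) g -> dot g x = dot g w).
Proof.
have [K CCK] := sym_factor.
have [w_orth xw_orth] : orthc (mxnull C) w /\ orthc (orthc (mxnull C)) (x - w).
  apply: (@xgetPex _ 0 [set w | orthc (mxnull C) w /\
    orthc (orthc (mxnull C)) (x - w)]); exists (C *m (K *m x)); split=> [u|u].
    by move=> Cu; rewrite dotC dot_mulmx C_sym Cu dot0l.
  move=> /= /(_ (x - C *m (K *m x))) u_orth; rewrite dotC u_orth//=.
  by rewrite /mxnull /= mulmxBr !mulmxA CCK subrr.
split=> // g /xw_orth; rewrite dotC dotDr dotNr => /subr0_eq; exact.
Qed.

End Kernel.

(** * Energy decrease and rate of the dualized iteration *)

Section Rate.
Context {R : realType} {n : nat}.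
Variables (B C D : 'M[R]_n) (F : 'cV[R]_n -> R) (G : 'cV[R]_n -> 'cV[R]_n).
Variables (L gamma : R) (ystar : 'cV[R]_n).
Hypotheses (B_psd : psd B) (C_psd : psd C) (D_psd : psd D).
Hypotheses (BC_comm : B *m C = C *m B).
Hypothesis IBDC_psd : psd (1%:M - 2^-1 *: C - sqrtmx B *m D *m sqrtmx B).
Hypotheses (Cystar : C *m ystar = 0) (Dystar : D *m ystar = ystar)
  (Bystar : B *m ystar = ystar).
(** The descent bound from u to v combined with the tangent inequality from u to w; the case [v = u]
    gives back the latter. *)
Hypothesis F_three_point : forall u v w,
  F v <= F w + dot (G u) (v - w) + L / 2 * dot (v - u) (v - u).
Hypothesis ystar_min : forall u, C *m u = 0 -> F ystar <= F u.
Hypotheses (L_gt0 : 0 < L) (gamma_gt0 : 0 < gamma).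
Hypothesis gamma_le : gamma * L <= lambda_min D.

Lemma dualized_step (y w q x' : 'cV[R]_n) (y' := B *m x') :
  x' = D *m y - gamma *: G y - C *m w ->
  gamma * (F y' - F ystar) + dot (C *m q) y' <=
  2^-1 * (dot (y - ystar) (D *m (y - ystar)) -
          dot (y' - ystar) (D *m (y' - ystar))) +
  2^-1 * (dot (w - q) (B *m C *m (w - q)) -
          dot (w + x' - q) (B *m C *m (w + x' - q))).
Proof.
move=> x'E; have [S_psd SS S_comm] := sqrtmx_psd B_psd.
have SC : sqrtmx B *m C = C *m sqrtmx B by exact: S_comm.
have dotD u v : dot u (D *m v) = dot v (D *m u).
  by rewrite dot_mulmx D_psd.1 dotC.
have dotCm u v : dot u (C *m v) = dot v (C *m u).
  by rewrite dot_mulmx C_psd.1 dotC.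
have BCx' u : dot u (B *m C *m x') = dot u (C *m y').
  by rewrite BC_comm mulmxA.
(* Hypothesis (e) tested at [sqrtmx B *m x']: since [sqrtmx B] commutes with C, the roots pair up
   into B and thus produce [y']. *)
have IBDC_ge0 :
    0 <= dot x' y' - 2^-1 * dot x' (C *m y') - dot y' (D *m y').
  have symS u v : dot (sqrtmx B *m u) v = dot u (sqrtmx B *m v).
    by rewrite dot_mulmx S_psd.1.
  have := IBDC_psd.2 (sqrtmx B *m x'); congr (_ <= _).
  rewrite !mulmxBl mul1mx -scalemxAl !dotE !symS !mulmxA SS SC.
  rewrite -(mulmxA C) SS -(mulmxA (B *m D)) SS -BC_comm.
  congr (_ - _ - _).
  by rewrite /y' -!mulmxA dot_mulmx B_psd.1.
have x'ystar : dot x' ystar = dot y' ystar.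
  by rewrite -{1}Bystar dot_mulmx B_psd.1.
(* The update expresses the gradient through [x'], [D *m y] and [C *m w]; the terms containing
   [C *m ystar] vanish. *)
have gG : gamma * dot (G y) (y' - ystar) = dot y' (D *m y) - dot y ystar
    - dot x' y' + dot y' ystar - dot w (C *m y').
  have -> : gamma * dot (G y) (y' - ystar) =
      dot (D *m y - x' - C *m w) (y' - ystar).
    by rewrite x'E -dotZl; congr dot; rewrite !opprB addrA [_ - C *m w]addrC;
      rewrite !addrA; apply/colP => i; rewrite !mxE; ring.
  rewrite !dotE x'ystar (dotC _ y') -(dotC ystar) (dotD ystar) Dystar.
  rewrite (dotC (C *m w) y') (dotCm y') (dotC (C *m w)) (dotCm ystar).
  by rewrite Cystar dot0r; ring.
(* The step-size bound lets the D-norm absorb the smoothness remainder. *)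
have Dyy : gamma * L * dot (y' - y) (y' - y) <=
    dot y' (D *m y') - 2 * dot y' (D *m y) + dot y (D *m y).
  apply: le_trans (_ : dot (y' - y) (D *m (y' - y)) <= _).
    by apply: le_trans (lambda_min_le _ D_psd); rewrite ler_wpM2r ?dot_ge0.
  by rewrite mulmxBr !dotE (dotD y y'); lra.
have D_diff : dot (y - ystar) (D *m (y - ystar)) -
    dot (y' - ystar) (D *m (y' - ystar)) = dot y (D *m y)
    - 2 * dot y ystar - dot y' (D *m y') + 2 * dot y' ystar.
  by rewrite !mulmxBr !dotE Dystar !(dotD ystar) Dystar; ring.
have BC_diff : dot (w - q) (B *m C *m (w - q)) -
    dot (w + x' - q) (B *m C *m (w + x' - q)) =
    2 * dot (C *m q) y' - 2 * dot w (C *m y') - dot x' (C *m y').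
  have -> : w + x' - q = (w - q) + x' by rewrite addrAC.
  have dotBC : dot x' (B *m C *m (w - q)) = dot (w - q) (C *m y').
    by rewrite dot_mulmx trmx_mul B_psd.1 C_psd.1 -BC_comm dotC BCx'.
  move: dotBC; have : dot (w - q) (C *m y') = dot w (C *m y') - dot q (C *m y').
    by rewrite dotDl dotNl.
  move: (w - q) => d dE dotBC; rewrite mulmxDr !dotE !BCx' dotBC dE.
  by rewrite (dotC (C *m q)) (dotCm y'); ring.
rewrite D_diff BC_diff; have := F_three_point y y' ystar.
rewrite -(ler_pM2l gamma_gt0) 2!(mulrDr gamma) gG; lra.
Qed.

Variables (y w x : nat -> 'cV[R]_n).
Hypothesis y_rec : forall k, y k.+1 = B *m x k.+1.
Hypothesis x_rec : forall k, x k.+1 = D *m y k - gamma *: G (y k) - C *m w k.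
Hypothesis w0 : w 0%N = 0.
Hypothesis w_rec : forall k, w k.+1 = w k + x k.+1.

Lemma dualized_sum q k :
  gamma * \sum_(1 <= t < k.+1) (F (y t) - F ystar) +
  dot (C *m q) (\sum_(1 <= t < k.+1) y t) <=
  2^-1 * (dot (y 0%N - ystar) (D *m (y 0%N - ystar)) +
          dot q (B *m C *m q)).
Proof.
(* BC = sqrt(B) C sqrt(B) is a congruence of C. *)
have BC_psd : psd (B *m C).
  have [S_psd SS S_comm] := sqrtmx_psd B_psd; split=> [|u].
    by rewrite trmx_mul B_psd.1 C_psd.1 BC_comm.
  rewrite -[X in X *m C]SS -(mulmxA _ _ C) (S_comm C) // -!mulmxA.
  by rewrite dot_mulmx S_psd.1; exact: C_psd.2.
(* The terminal energy is kept on the left so that the induction telescopes; being nonnegative, it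
   can be discarded. *)
suff: gamma * \sum_(1 <= t < k.+1) (F (y t) - F ystar) +
    dot (C *m q) (\sum_(1 <= t < k.+1) y t) +
    2^-1 * (dot (y k - ystar) (D *m (y k - ystar)) +
            dot (w k - q) (B *m C *m (w k - q))) <=
    2^-1 * (dot (y 0%N - ystar) (D *m (y 0%N - ystar)) +
            dot q (B *m C *m q)).
  have := D_psd.2 (y k - ystar); have := BC_psd.2 (w k - q); lra.
elim: k => [|k IH].
  by rewrite !big_geq// w0 sub0r mulmxN !dotE dot0r; lra.
rewrite !(big_nat_recr k.+1)//= mulrDr dotDr.
have := @dualized_step (y k) (w k) q _ (x_rec k).
rewrite -y_rec -w_rec; lra.
Qed.

Lemma avg_gap q k : (0 < k)%N ->
  gamma * (F (avg y k) - F ystar) + dot (C *m q) (avg y k) <=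
  2^-1 * (dot (y 0%N - ystar) (D *m (y 0%N - ystar)) +
          dot q (B *m C *m q)) / k%:R.
Proof.
move=> k_gt0; have k0 : 0 < k%:R :> R by rewrite ltr0n.
rewrite ler_pdivlMr//; apply: le_trans (dualized_sum q k).
have sumE : \sum_(1 <= t < k.+1) y t = k%:R *: avg y k.
  by rewrite /avg scalerA divff ?scale1r// gt_eqF.
rewrite sumE dotZr mulrDl (mulrC (dot _ _)) lerD2r -mulrA ler_wpM2l ?(ltW gamma_gt0)//.
(* Jensen's inequality through tangents at the average: their linear parts sum to zero. *)
have tangent u : F (avg y k) + dot (G (avg y k)) (u - avg y k) <= F u.
  have := F_three_point (avg y k) (avg y k) u; rewrite subrr dot0r !dotE; lra.
have -> : (F (avg y k) - F ystar) * k%:R = \sum_(1 <= t < k.+1)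
    (F (avg y k) + dot (G (avg y k)) (y t - avg y k) - F ystar).
  rewrite sumrB big_split /= -dot_sumr sumrB sumE.
  by rewrite !sumr_const_nat subn1 /= scaler_nat subrr dot0r addr0 -mulrnBl mulr_natr.
by apply: ler_sum => t _; rewrite lerD2r.
Qed.

(** Along u in the kernel of C, minimality and smoothness give 0 <= t <G ystar, u> + t^2 (L/2) |u|^2
    for every t. *)
Lemma grad_ystar_orthc : orthc (mxnull C) (G ystar).
Proof.
move=> u Cu; apply: (@linear_coef_eq0 _ _ (L / 2 * dot u u)) => [|t].
  by rewrite mulr_ge0 ?dot_ge0// divr_ge0 ?(ltW L_gt0).
have := F_three_point ystar (ystar + t *: u) ystar.
have := @ystar_min (ystar + t *: u); rewrite (addrAC ystar) subrr add0r !dotE.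
rewrite mulmxDr -scalemxAr Cu Cystar scaler0 addr0 => /(_ erefl); lra.
Qed.

Lemma avg_rate : exists2 c : R, 0 <= c & forall k, (0 < k)%N ->
  Num.max (enorm (oproj (orthc (mxnull C)) (avg y k)) * enorm (G ystar))
    `|F (avg y k) - F ystar| <= c / k%:R.
Proof.
have [K CCK] := sym_factor C_psd.1.
have [c0 c0_ge0 c0_le] := quad_form_le (K^T *m (B *m C) *m K).
set g := enorm (G ystar); set d0 := dot (y 0%N - ystar) (D *m (y 0%N - ystar)).
(* This is the bound of [avg_gap] for [q = K *m r] with |r| <= 2 gamma g, divided by gamma; [c0]
   bounds the BC-energy of [K *m r] by |r|^2. *)
pose c := 2^-1 * (d0 + c0 * (2 * gamma * g) ^+ 2) / gamma.
have d0_ge0 : 0 <= d0 by exact: D_psd.2.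
have g_ge0 : 0 <= g by exact: enorm_ge0.
exists c => [|k k_gt0].
  by rewrite divr_ge0 ?(ltW gamma_gt0)// mulr_ge0 ?invr_ge0// addr_ge0 // mulr_ge0 ?sqr_ge0.
set v := avg y k; set p := oproj _ v.
have [p_orth dot_p] := oproj_orthc_null C_psd.1 v; rewrite -/p in p_orth dot_p.
have p_ge0 : 0 <= enorm p by exact: enorm_ge0.
(* The prescribed value of Cq. When the projection p is zero, division by zero returns 0 and r is
   zero. *)
pose r := (2 * gamma * g / enorm p) *: p.
have r_orth : orthc (mxnull C) r by move=> u /p_orth; rewrite dotZl => ->; rewrite mulr0.
have CKr := orthc_null_range C_psd.1 CCK r_orth.
have rv : dot r v = 2 * gamma * (enorm p * g).
  rewrite dot_p// dotZl -enorm_sqr; have [->|p0] := eqVneq (enorm p) 0.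
    by rewrite expr0n !(mulr0, mul0r).
  by field.
have rr : dot r r <= (2 * gamma * g) ^+ 2.
  rewrite !dotE -enorm_sqr; have [->|p0] := eqVneq (enorm p) 0.
    by rewrite expr0n !(mulr0, mul0r) sqr_ge0.
  by rewrite le_eqVlt; apply/orP; left; apply/eqP; field.
(* Tangent at [ystar]: the gradient there is orthogonal to the kernel of C, so only the projection
   of the average contributes. *)
have gap_ge : - (enorm p * g) <= F v - F ystar.
  have := F_three_point ystar ystar v; rewrite subrr dot0r -opprB dotNr dotDr dotNr.
  have Gystar0 : dot (G ystar) ystar = 0 by exact: grad_ystar_orthc.
  rewrite Gystar0 (dot_p _ grad_ystar_orthc).
  have := cauchy_schwarz (G ystar) p; rewrite ler_norml => /andP[+ _].
  by rewrite -/g mulrC; lra.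
have gap_le : (F v - F ystar) + 2 * (enorm p * g) <= c / k%:R.
  rewrite -(ler_pM2l gamma_gt0) mulrDr.
  have := @avg_gap (K *m r) k k_gt0; rewrite CKr rv -/v.
  have Kr : dot (K *m r) (B *m C *m (K *m r)) <= c0 * (2 * gamma * g) ^+ 2.
    apply: le_trans (_ : c0 * dot r r <= _); last by rewrite ler_wpM2l.
    by apply: le_trans (c0_le r); rewrite -!mulmxA [X in _ <= X]dot_mulmx trmxK.
  have -> : gamma * (c / k%:R) = 2^-1 * (d0 + c0 * (2 * gamma * g) ^+ 2) / k%:R.
    by rewrite /c; field; rewrite !gt_eqF ?ltr0n.
  move=> h; apply: le_trans (le_trans h _); first lra.
  by rewrite ler_wpM2r ?invr_ge0// ler_wpM2l ?invr_ge0// lerD2l.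
(* With s = [enorm p * g], gap >= -s and gap + 2s <= c/k give s <= c/k and |gap| <= c/k; this is why
   r carries the factor 2. *)
have pg_ge0 : 0 <= enorm p * g by rewrite mulr_ge0.
by rewrite ge_max ler_norml; apply/and3P; split; lra.
Qed.

End Rate.

(** * Tangent and descent inequalities for convex smooth functions *)

Section Smooth.
Context {R : realType} {n : nat}.
Implicit Types (f : 'cV[R]_n -> R) (u v w h : 'cV[R]_n).

Lemma derive_grad f u h : differentiable f u -> 'D_h f u = dot (grad f u) h.
Proof.
move=> df; have {1}-> : h = \sum_i h i 0 *: delta_mx i 0.
  rewrite {1}(matrix_sum_delta h); apply: eq_bigr => i _.
  by rewrite big_ord1.
rewrite deriveE// linear_sum; apply: eq_bigr => i _.
by rewrite linearZ /= mxE deriveE// mulrC.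
Qed.

(** Convexity bounds the difference quotients with t in (0,1) by f w - f u; the limit is taken from
    the right. *)
Lemma convex_tangent f u w : differentiable f u ->
  convex_function [set: 'cV[R]_n] f -> f u + dot (grad f u) (w - u) <= f w.
Proof.
move=> df f_convex; rewrite -derive_grad// -lerBrDl.
have dfl := @diff_derivable _ _ _ f u (w - u) df.
have /cvg_dnbhs_at_right cvg_q := dfl.
apply: (cvgr_to_le cvg_q); near=> t.
have t_gt0 : 0 < t by near: t; exact: nbhs_right_gt.
have t_lt1 : t < 1 by near: t; exact: nbhs_right_lt.
have cv : f (t *: w + (1 - t) *: u) <= t * f w + (1 - t) * f u.
  exact: (f_convex (Itv01 (ltW t_gt0) (ltW t_lt1)) w u (in_setT _) (in_setT _)).
rewrite /= /GRing.scale /= ler_pdivrMl//.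
have -> : t *: (w - u) + u = t *: w + (1 - t) *: u.
  by rewrite scalerBr scalerBl scale1r addrAC addrA.
apply: le_trans (_ : _ <= t * f w + (1 - t) * f u - f u) _; first by rewrite lerD2r.
lra.
Unshelve. all: by end_near. Qed.

Lemma descent f (L : R) u v : L_smooth L f ->
  f v <= f u + dot (grad f u) (v - u) + L / 2 * dot (v - u) (v - u).
Proof.
move=> [df gradL]; set h := v - u.
pose a := dot (grad f u) h; pose b := dot h h.
(* The linear and quadratic terms are subtracted along the segment; by the mean value theorem the
   increment of [psi] is one of its derivatives, which the Lipschitz bound makes nonpositive. *)
pose psi (t : R) := f (t *: h + u) - (t * a + (L / 2 * b) * t ^+ 2).
have psi_der (t : R) : is_derive t 1 psi
    (dot (grad f (t *: h + u)) h - (a + L * b * t)).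
  have dphi : is_derive t 1 (fun t : R => f (t *: h + u))
      (dot (grad f (t *: h + u)) h).
    have quotE : (fun e : R => e^-1 *: (((fun t : R => f (t *: h + u)) \o shift t)
        (e *: (1 : R)) - f (t *: h + u))) =
        (fun e => e^-1 *: ((f \o shift (t *: h + u)) (e *: h) - f (t *: h + u))).
      by apply/funext => e /=; rewrite [e *: _]mulr1 scalerDl addrA.
    rewrite -derive_grad//; apply: DeriveDef.
      rewrite /derivable quotE; exact: diff_derivable.
    by rewrite /derive quotE.
  apply: is_deriveB; apply: is_derive_eq.
  by rewrite /GRing.scale /=; field.
have [|c] := @MVT _ psi _ 0 1 ltr01 (fun t _ => psi_der t).
  by apply: derivable_within_continuous => t _; exact: ex_derive.
rewrite in_itv /= => /andP[c_gt0 _].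
rewrite /psi !(scale0r, scale1r, mul0r, mul1r, expr0n, expr1n, subr0, mulr0).
rewrite add0r mulr1 subrK => psiE.
suff : dot (grad f (c *: h + u)) h - a <= L * b * c by rewrite -/a -/b; lra.
rewrite /a -dotNl -dotDl; apply: le_trans (ler_norm _) _.
apply: le_trans (cauchy_schwarz _ _) _.
apply: le_trans (ler_wpM2r (enorm_ge0 h) (gradL _ _)) _.
by rewrite addrK enormZ gtr0_norm// /b -enorm_sqr; lra.
Qed.

Lemma three_point f (L : R) u v w :
  convex_function [set: 'cV[R]_n] f -> L_smooth L f ->
  f v <= f w + dot (grad f u) (v - w) + L / 2 * dot (v - u) (v - u).
Proof.
move=> f_convex f_smooth; have := descent u v f_smooth.
have := convex_tangent w (f_smooth.1 u) f_convex; rewrite !dotE; lra.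
Qed.

End Smooth.

(** * Stacked cost and consensus space *)

Lemma dot_submxcol {R : realType} {P : nat} (n : 'I_P -> nat)
    (x y : 'cV[R]_(\sum_p n p)) :
  dot x y = \sum_p dot (submxcol x p) (submxcol y p).
Proof.
rewrite dot_trmx -[x]submxcolK -[y]submxcolK tr_mxcol mul_mxrow_mxcol summxE.
by apply: eq_bigr => p _; rewrite !mxcolK dot_trmx.
Qed.

Section Network.
Context {R : realType} {P N : nat}.
Variables (EE : {set 'I_P * 'I_N}) (n : 'I_P -> nat).
Local Notation stacked := 'cV[R]_(\sum_p deg EE p * n p).
Implicit Types (Y : stacked) (i : 'I_N).

Lemma estimate_linear Y Y' (t : R) p (a : 'I_(deg EE p)) :
  estimate (t *: Y + Y') a = t *: estimate Y a + estimate Y' a.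
Proof. by apply/colP => j; rewrite !mxE. Qed.

(* [local_estimates] with the agent first, so as to be recognized as a linear
   map. *)
Definition local_view i Y : 'cV[R]_(\sum_p n p) := local_estimates Y i.

Lemma local_view_is_linear i : linear (local_view i).
Proof.
move=> t Y Y'; apply/mxcolP => p.
have -> (x x' : 'cV[R]_(\sum_p n p)) :
    submxcol (t *: x + x') p = t *: submxcol x p + submxcol x' p.
  by apply/matrixP => j k; rewrite !mxE.
rewrite /local_view /local_estimates !mxcolK.
case: pickP => [a _|_]; first exact: estimate_linear.
by rewrite scaler0 addr0.
Qed.

HB.instance Definition _ i := GRing.isLinear.Build R stacked
  'cV[R]_(\sum_p n p) _ (local_view i) (local_view_is_linear i).

(** Every estimate is held by exactly one agent. This is what preserves the constant L when the
    inequalities of the agents are summed. *)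
Lemma dot_local_estimates Y :
  \sum_i dot (local_estimates Y i) (local_estimates Y i) = dot Y Y.
Proof.
rewrite [LHS](eq_bigr _ (fun i _ => dot_submxcol _ _)) [LHS]exchange_big /=.
rewrite [RHS]dot_submxcol; apply: eq_bigr => p _.
transitivity (\sum_(a < deg EE p) dot (estimate Y a) (estimate Y a)); last first.
  rewrite pair_bigA [RHS](reindex (@mxtens_index _ _)) /=; last first.
    exists (@mxtens_unindex _ _) => x _; first exact: mxtens_indexK.
    exact: mxtens_unindexK.
  by apply: eq_bigr => -[a j] _; rewrite mxE.
rewrite (partition_big (fun a : 'I_(deg EE p) => enum_val a) xpredT)//=.
apply: eq_bigr => i _; rewrite mxcolK; case: pickP => [a /eqP ai|no_a].
  rewrite (big_pred1 a)// => b /=; rewrite -ai; apply/eqP/eqP => [|->//].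
  exact: enum_val_inj.
by rewrite big_pred0// dot0l.
Qed.

Lemma consensusE : consensus EE n = range (@consensus_at R P N EE n).
Proof.
apply/seteqP; split=> [Y [v ->]|_ [y _ <-]].
  exists (\mxcol_p v p) => //; rewrite /consensus_at.
  by apply/mxcolP => p; rewrite !mxcolK.
by exists (submxcol y).
Qed.

Variables (EI : {set 'I_P * 'I_N}) (f : 'I_N -> 'cV[R]_(\sum_p n p) -> R).
Hypotheses (EI_sub_EE : EI \subset EE) (f_dep : forall i, depends_only_on EI i (f i)).

(** Agent i reads only blocks joined to it in [EI], hence in [EE], where it holds an estimate; the
    zero completion is never read. *)
Lemma stacked_cost_consensus_at y :
  stacked_cost f (consensus_at EE y) = \sum_i f i y.
Proof.
apply: eq_bigr => i _; apply: f_dep => p pi; rewrite mxcolK.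
have i_p : i \in nbrs EE p by rewrite inE (fintype.subsetP EI_sub_EE).
case: pickP => [a _|/(_ (enum_rank_in i_p i))]; last first.
  by rewrite enum_rankK_in ?eqxx.
apply/colP => j; rewrite mxE mxcolK mxE mxtens_indexK /= mxE mul1r.
by congr (submxcol y p j _); exact: ord1.
Qed.

Variable L : R.
Hypothesis f_convex : forall i, convex_function [set: 'cV[R]_(\sum_p n p)] (f i).
Hypothesis f_smooth : forall i, L_smooth L (f i).

Lemma dot_grad_stacked_cost Y H : dot (grad (stacked_cost f) Y) H =
  \sum_i dot (grad (f i) (local_view i Y)) (local_view i H).
Proof.
have derE V : 'D_V (stacked_cost f) Y =
    \sum_i dot (grad (f i) (local_view i Y)) (local_view i V).
  (* Linearity of [local_view] splits the difference quotient into those of the agents, whose limits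
     are known. *)
  have quotE : (fun e : R => e^-1 *: ((stacked_cost f \o shift Y) (e *: V)
      - stacked_cost f Y)) = (fun e => \sum_i e^-1 *:
      ((f i \o shift (local_view i Y)) (e *: local_view i V)
        - f i (local_view i Y))).
    apply/funext => e; rewrite -sumrB scaler_sumr; apply: eq_bigr => i _ /=.
    by rewrite -linearZ -linearD.
  rewrite /derive quotE; apply: cvg_lim => //.
  have df i := (f_smooth i).1 (local_view i Y).
  rewrite (eq_bigr _ (fun i _ => esym (derive_grad (local_view i V) (df i)))).
  apply: cvg_big => [|i _]; first exact: add_continuous.
  exact: diff_derivable.
have -> : dot (grad (stacked_cost f) Y) H = \sum_j \sum_i
    dot (grad (f i) (local_view i Y)) (local_view i (delta_mx j 0)) * H j 0.
  by apply: eq_bigr => j _; rewrite mxE derE mulr_suml.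
rewrite [LHS]exchange_big; apply: eq_bigr => i _ /=.
rewrite [in RHS](matrix_sum_delta H) linear_sum dot_sumr; apply: eq_bigr => j _.
by rewrite big_ord1 linearZ dotZr mulrC.
Qed.

Lemma stacked_three_point (U V W : stacked) :
  stacked_cost f V <= stacked_cost f W +
    dot (grad (stacked_cost f) U) (V - W) + L / 2 * dot (V - U) (V - U).
Proof.
rewrite dot_grad_stacked_cost -dot_local_estimates mulr_sumr -!big_split /=.
apply: ler_sum => i _; rewrite -!/(local_view i _) !linearB.
exact: three_point.
Qed.

End Network.

Theorem theorem1 (R : realType) (N P : nat) (n : 'I_P -> nat)
  (EI EE : {set 'I_P * 'I_N})
  (EI_nonempty : forall p, exists i, (p, i) \in EI)
  (EI_sub_EE : EI \subset EE)
  (f : 'I_N -> 'cV[R]_(\sum_p n p) -> R)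
  (f_dep : forall i, depends_only_on EI i (f i))
  (L : R) (L_gt0 : 0 < L)
  (f_convex : forall i, convex_function [set: 'cV[R]_(\sum_p n p)] (f i))
  (f_smooth : forall i, L_smooth L (f i))
  (A_ B_ C_ D_ : forall p, 'M[R]_(deg EE p))
  (A := diag_kron n A_) (B := diag_kron n B_)
  (C := diag_kron n C_) (D := diag_kron n D_)
  (A_BD : A = B *m D) (B_psd : psd B) (D_pd : posdef D)
  (DB_consensus : forall Y, consensus EE n Y -> D *m Y = Y /\ B *m Y = Y)
  (C_psd : psd C) (C_null : mxnull C = consensus EE n)
  (BC_comm : B *m C = C *m B)
  (IBDC_psd : psd (1%:M - 2^-1 *: C - sqrtmx B *m D *m sqrtmx B))
  (ystar : 'cV[R]_(\sum_p n p))
  (ystar_sol : minimizers (fun y => \sum_i f i y) ystar)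
  (gamma : R) (gamma_gt0 : 0 < gamma) (gamma_lt : gamma < lambda_min D / L)
  (y z : nat -> 'cV[R]_(\sum_p deg EE p * n p))
  (z0 : z 0%N = 0)
  (y_rec : forall k,
     y k.+1 = A *m y k - gamma *: (B *m grad (stacked_cost f) (y k)) - z k)
  (z_rec : forall k, z k.+1 = z k + C *m y k.+1) :
  exists2 c : R, 0 <= c &
    forall k : nat, (1 <= k)%N ->
      merit f (consensus_at EE ystar) (avg y k) <= c / k%:R.
Proof.
set Y := consensus_at EE ystar; pose F := @stacked_cost R P N EE n f; pose G := grad F.
have [K_Y K_min] : consensus EE n Y /\
    (forall U, consensus EE n U -> F Y <= F U).
  rewrite consensusE; split=> [|_ [u _ <-]]; first by exists ystar.
  by rewrite /F /Y !(stacked_cost_consensus_at EI_sub_EE f_dep); exact: ystar_sol.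
have [DY BY] := DB_consensus _ K_Y.
rewrite /merit -C_null; rewrite -C_null in K_Y K_min.
(* The increment is [x j.+1] written out, so that w is a single recursion and [w_rec] holds by
   computation; [k.-1] in x undoes the index shift. *)
pose w := fix w k : 'cV[R]_(\sum_p deg EE p * n p) :=
  if k is j.+1 then w j + (D *m y j - gamma *: G (y j) - C *m w j) else 0.
pose x k := D *m y k.-1 - gamma *: G (y k.-1) - C *m w k.-1.
have w_rec k : w k.+1 = w k + x k.+1 by [].
have y_x k : z k = B *m C *m w k -> y k.+1 = B *m x k.+1.
  by move=> zk; rewrite y_rec zk A_BD /x /= !mulmxBr -scalemxAr !mulmxA.
(* The relation propagates because C y^{k+1} = CB x^{k+1} = BC x^{k+1}. *)
have z_w k : z k = B *m C *m w k.
  elim: k => [|k zk]; first by rewrite z0 mulmx0.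
  rewrite z_rec y_x// zk w_rec; move: (x k.+1) => u.
  by rewrite mulmxDr (mulmxA C) BC_comm.
have gamma_le : gamma * L <= lambda_min D.
  by rewrite -ler_pdivlMr// ltW.
apply: (@avg_rate _ _ B C D F G L gamma Y B_psd C_psd (posdef_psd D_pd) BC_comm
  IBDC_psd K_Y DY BY _ K_min L_gt0 gamma_gt0 gamma_le y w x) => //.
- exact: stacked_three_point.
- by move=> k; exact: y_x.
Qed.
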